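(* Let $C=(C_\bullet,d,t)$ be a para-precyclic $k$-module. Then $C^{\natural\natural}:=(C^{\natural\natural}_\bullet,\partial+\delta,u^{-2},T)$ is a para-$S$-module.
   Context: $k$ is a unital ring, not assumed commutative; $k$-modules are left modules. A para-$S$-module $(C_\bullet,d,S,T)$ consists of $k$-modules $C_m$ ($m\ge 0$), $k$-linear maps $d:C_\bullet\to C_{\bullet-1}$, $S:C_\bullet\to C_{\bullet-2}$ and a $k$-linear isomorphism $T:C_\bullet\to C_\bullet$ such that $d^2=S(1-T)$ and $d,S,T$ commute pairwise. A para-precyclic $k$-module consists of $k$-modules $C_m$, $m\ge0$, face maps $d_j:C_m\to C_{m-1}$ ($0\le j\le m$) with $d_id_j=d_{j-1}d_i$ for $i<j$, and an invertible $k$-linear map $t:C_\bullet\to C_\bullet$ of degree $0$ with $td_i=d_{i+1}t$ for $0\le i\le m-1$ and $d_m=d_0t$ on $C_m$. The notation $(C_\bullet,d,t)$ uses $d=d_m$ on $C_m$, which together with $t$ determines all faces. Put $T=t^{m+1}$ on $C_m$; it commutes with $d$ and $t$. Let $b=\sum_{j=0}^m(-1)^jd_j$, $b'=\sum_{j=0}^{m-1}(-1)^jd_j$, $\tau=(-1)^mt$, $N=1+\tau+\cdots+\tau^m$ on $C_m$. Let $C^{\natural\natural}_m=\bigoplus_{p+q=m}C_qu^p$ ($p,q\ge0$), with $u$ a formal variable, $u^{-1}(xu^p)=xu^{p-1}$ for $p\ge1$, $u^{-1}(xu^0)=0$, $u^{-2}=(u^{-1})^2$, and $T$ acting on coefficients.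 The maps $\partial,\delta:C^{\natural\natural}_\bullet\to C^{\natural\natural}_{\bullet-1}$ are $\partial(xu^{2p+1})=(1-\tau)xu^{2p}$, $\partial(xu^{2p})=Nxu^{2p-1}$ for $p\ge1$, $\partial(xu^0)=0$, and $\delta(xu^{2p})=bxu^{2p}$, $\delta(xu^{2p+1})=-b'xu^{2p+1}$. *)

(* Defs.v *)
From HB Require Import structures.
From mathcomp Require Import all_boot all_algebra.

Set Implicit Arguments.
Unset Strict Implicit.
Unset Printing Implicit Defensive.

Import GRing.Theory.
Local Open Scope ring_scope.

(* A graded module is a family indexed by nat, zero in negative degrees.  A
   map of degree -1 (resp. -2) is thus given by its components starting in
   degree m.+1 (resp. m.+2): in lower degrees its target is zero, and the
   relations with values in negative degrees hold trivially. *)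

Record is_para_S_module (k : pzRingType) (C : nat -> lmodType k)
    (d : forall m, C m.+1 -> C m) (S : forall m, C m.+2 -> C m)
    (T : forall m, C m -> C m) : Prop := IsParaSModule {
  para_S_d_linear : forall m, linear (d m);
  para_S_S_linear : forall m, linear (S m);
  para_S_T_linear : forall m, linear (T m);
  para_S_T_bij : forall m, bijective (T m);
  para_S_dd : forall m (x : C m.+2), d m (d m.+1 x) = S m (x - T m.+2 x);
  para_S_dS : forall m (x : C m.+3), d m (S m.+1 x) = S m (d m.+2 x);
  para_S_dT : forall m (x : C m.+1), d m (T m.+1 x) = T m (d m x);
  para_S_ST : forall m (x : C m.+2), S m (T m.+2 x) = T m (S m x)
}.

(* [face m j] is d_j : C_{m+1} -> C_m, for 0 <= j <= m+1. *)
Record para_precyclic (k : pzRingType) := ParaPrecyclic {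
  pcmod :> nat -> lmodType k;
  face : forall m, 'I_m.+2 -> {linear pcmod m.+1 -> pcmod m};
  pct : forall m, {linear pcmod m -> pcmod m};
  face_face : forall m (i j : nat) (x : pcmod m.+2), (i < j <= m.+2)%N ->
    face (inord i) (face (inord j) x) = face (inord j.-1) (face (inord i) x);
  pct_bij : forall m, bijective (pct m);
  pct_face : forall m (i : nat) (x : pcmod m.+1), (i <= m)%N ->
    pct m (face (inord i) x) = face (inord i.+1) (pct m.+1 x);
  face_last : forall m (x : pcmod m.+1),
    face ord_max x = face ord0 (pct m.+1 x)
}.

Section Operators.
Variables (k : pzRingType) (C : para_precyclic k).

Definition pcT m (x : C m) : C m := iter m.+1 (pct C m) x.

Definition pctau m (x : C m) : C m := (-1) ^+ m *: pct C m x.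

Definition pcN m (x : C m) : C m := \sum_(i < m.+1) iter i (@pctau m) x.

Definition pcb m (x : C m.+1) : C m :=
  \sum_(j < m.+2) (-1) ^+ j *: face C j x.

Definition pcb' m (x : C m.+1) : C m :=
  \sum_(j < m.+1) (-1) ^+ j *: face C (widen_ord (leqnSn m.+1) j) x.

End Operators.

(* The direct sum of the C_q u^p over p + q = m, indexed by q : 'I_m.+1: a
   family x stands for the sum of the (x q) u^(m - q). *)
Definition natnat (k : pzRingType) (C : nat -> lmodType k) (m : nat) : Type :=
  {dffun forall q : 'I_m.+1, C q}.

Section NatnatModule.
Variables (k : pzRingType) (C : nat -> lmodType k) (m : nat).
Implicit Types x y : natnat C m.

HB.instance Definition _ :=
  Choice.copy (natnat C m) {dffun forall q : 'I_m.+1, C q}.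

Definition natnat_zero : natnat C m := [ffun q : 'I_m.+1 => (0 : C q)].
Definition natnat_opp x : natnat C m := [ffun q : 'I_m.+1 => (- x q : C q)].
Definition natnat_add x y : natnat C m :=
  [ffun q : 'I_m.+1 => (x q + y q : C q)].
Definition natnat_scale (a : k) x : natnat C m :=
  [ffun q : 'I_m.+1 => (a *: x q : C q)].

Fact natnat_addA : associative natnat_add.
Proof. by move=> x y z; apply/ffunP => q; rewrite !ffunE addrA. Qed.
Fact natnat_addC : commutative natnat_add.
Proof. by move=> x y; apply/ffunP => q; rewrite !ffunE addrC. Qed.
Fact natnat_add0 : left_id natnat_zero natnat_add.
Proof. by move=> x; apply/ffunP => q; rewrite !ffunE add0r. Qed.
Fact natnat_addN : left_inverse natnat_zero natnat_opp natnat_add.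
Proof. by move=> x; apply/ffunP => q; rewrite !ffunE addNr. Qed.

HB.instance Definition _ := GRing.isZmodule.Build (natnat C m)
  natnat_addA natnat_addC natnat_add0 natnat_addN.

Fact natnat_scaleA a b x :
  natnat_scale a (natnat_scale b x) = natnat_scale (a * b) x.
Proof. by apply/ffunP => q; rewrite !ffunE scalerA. Qed.
Fact natnat_scale1 : left_id 1 natnat_scale.
Proof. by move=> x; apply/ffunP => q; rewrite !ffunE scale1r. Qed.
Fact natnat_scaleDr : right_distributive natnat_scale +%R.
Proof. by move=> a x y; apply/ffunP => q; rewrite !ffunE scalerDr. Qed.
Fact natnat_scaleDl x : {morph natnat_scale^~ x : a b / a + b}.
Proof. by move=> a b; apply/ffunP => q; rewrite !ffunE scalerDl. Qed.

HB.instance Definition _ := GRing.Zmodule_isLmodule.Build k (natnat C m)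
  natnat_scaleA natnat_scale1 natnat_scaleDr natnat_scaleDl.

(* The monomial x u^(m - q). *)
Definition monom (q : 'I_m.+1) (x : C q) : natnat C m :=
  [ffun j : 'I_m.+1 => (dfwith (fun i : 'I_m.+1 => 0 : C i) x j : C j)].

End NatnatModule.

Section NatnatMaps.
Variables (k : pzRingType) (C : para_precyclic k).

(* Below, [widen_ord (leqnSn _) q] and [lift ord0 q] are q and q.+1 seen in
   'I_m.+2.  The coefficient of u^(m - q) in the image of the family x of
   degree m.+1 comes from the term (x q) u^(m.+1 - q) for u^-1 and \partial,
   and from the term (x q.+1) u^(m - q) for \delta.  The action on monomials
   is given by the lemmas after the definitions. *)

Definition uinv m (x : natnat C m.+1) : natnat C m :=
  [ffun q : 'I_m.+1 => (x (widen_ord (leqnSn m.+1) q) : C q)].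

Definition uinv2 m (x : natnat C m.+2) : natnat C m := uinv (uinv x).

Definition natnat_partial m (x : natnat C m.+1) : natnat C m :=
  [ffun q : 'I_m.+1 =>
    let y : C q := x (widen_ord (leqnSn m.+1) q) in
    (if odd (m.+1 - q) then y - pctau y else pcN y) : C q].

Definition natnat_delta m (x : natnat C m.+1) : natnat C m :=
  [ffun q : 'I_m.+1 =>
    let y : C q.+1 := x (lift ord0 q) in
    (if odd (m - q) then - pcb' y else pcb y) : C q].

Definition natnat_d m (x : natnat C m.+1) : natnat C m :=
  natnat_partial x + natnat_delta x.

Definition natnat_T m (x : natnat C m) : natnat C m :=
  [ffun q : 'I_m.+1 => (pcT (x q) : C q)].

End NatnatMaps.

Section Monomials.
Variables (k : pzRingType) (C : para_precyclic k).

Let pcN0 m : pcN (0 : C m) = 0.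
Proof.
apply: big1 => i _; elim: (val i) => //= n ->.
by rewrite /pctau linear0 scaler0.
Qed.
Let pctau0 m : pctau (0 : C m) = 0.
Proof. by rewrite /pctau linear0 scaler0. Qed.
Let pcb0 m : pcb (0 : C m.+1) = 0.
Proof. by apply: big1 => i _; rewrite linear0 scaler0. Qed.
Let pcb'0 m : pcb' (0 : C m.+1) = 0.
Proof. by apply: big1 => i _; rewrite linear0 scaler0. Qed.
Let pcT0 m : pcT (0 : C m) = 0.
Proof. by rewrite /pcT; elim: m.+1 => //= n ->; rewrite linear0. Qed.

Lemma monomE m (q : 'I_m.+1) (x : C q) : monom x q = x.
Proof. by rewrite ffunE dfwith_in. Qed.

Lemma monom_out m (q j : 'I_m.+1) (x : C q) : q != j -> monom x j = 0.
Proof. by move=> qj; rewrite ffunE dfwith_out. Qed.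

Lemma natnat_sum m (x : natnat C m) : x = \sum_(q < m.+1) monom (x q).
Proof.
apply/ffunP => j; have E (I : seq 'I_m.+1) (F : 'I_m.+1 -> natnat C m) :
  (\sum_(i <- I) F i) j = \sum_(i <- I) F i j.
  by elim: I => [|i I IH]; rewrite ?big_nil ?big_cons ffunE ?IH.
rewrite E (bigD1 j) //= monomE big1 ?addr0 // => i ij.
exact: monom_out.
Qed.

Lemma uinv_monom m (q : 'I_m.+1) (x : C q) :
  uinv (@monom k C m.+1 (widen_ord (leqnSn m.+1) q) x) = monom x.
Proof.
apply/ffunP => j; rewrite [LHS]ffunE; case: (eqVneq q j) => [<-|qj].
  by rewrite [RHS]monomE (@monomE m.+1 (widen_ord (leqnSn m.+1) q) x).
by rewrite !monom_out.
Qed.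

Lemma uinv_monom_max m (x : C m.+1) :
  uinv (@monom k C m.+1 ord_max x) = 0.
Proof.
apply/ffunP => j; rewrite [LHS]ffunE [RHS]ffunE monom_out //.
by rewrite -val_eqE /= gtn_eqF.
Qed.

Lemma partial_monom m (q : 'I_m.+1) (x : C q) :
  natnat_partial (@monom k C m.+1 (widen_ord (leqnSn m.+1) q) x) =
  @monom k C m q (if odd (m.+1 - q) then x - pctau x else pcN x).
Proof.
apply/ffunP => j; rewrite [LHS]ffunE /=; case: (eqVneq q j) => [<-|qj].
  by rewrite [RHS]monomE (@monomE m.+1 (widen_ord (leqnSn m.+1) q) x).
by rewrite !monom_out // pctau0 pcN0 subr0 if_same.
Qed.

Lemma partial_monom_max m (x : C m.+1) :
  natnat_partial (@monom k C m.+1 ord_max x) = 0.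
Proof.
apply/ffunP => j; rewrite [LHS]ffunE [RHS]ffunE monom_out /=; last first.
  by rewrite -val_eqE /= gtn_eqF.
by rewrite pctau0 pcN0 subr0 if_same.
Qed.

Lemma delta_monom m (q : 'I_m.+1) (x : C q.+1) :
  natnat_delta (@monom k C m.+1 (lift ord0 q) x) =
  @monom k C m q (if odd (m - q) then - pcb' x else pcb x).
Proof.
apply/ffunP => j; rewrite [LHS]ffunE /=; case: (eqVneq q j) => [<-|qj].
  by rewrite [RHS]monomE (@monomE m.+1 (lift ord0 q) x).
by rewrite !monom_out ?pcb0 ?pcb'0 ?oppr0 ?if_same.
Qed.

Lemma delta_monom0 m (x : C 0) :
  natnat_delta (@monom k C m.+1 ord0 x) = 0.
Proof.
apply/ffunP => j; rewrite [LHS]ffunE [RHS]ffunE monom_out //=.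
by rewrite pcb0 pcb'0 oppr0 if_same.
Qed.

Lemma T_monom m (q : 'I_m.+1) (x : C q) :
  natnat_T (monom x) = @monom k C m q (pcT x).
Proof.
apply/ffunP => j; rewrite [LHS]ffunE; case: (eqVneq q j) => [<-|qj].
  by rewrite !monomE.
by rewrite !monom_out ?pcT0.
Qed.

End Monomials.

(* Main.v *)
From HB Require Import structures.
Require Import Defs.
From mathcomp Require Import all_boot all_algebra.

(** The differential [natnat_d] is that of the total complex of the cyclic
bicomplex, whose columns alternate between [(C, b)] and [(C, - b')] and whose
rows alternate between [1 - tau] and [N].  Squaring it and collecting the
coefficients of each power of u leaves three kinds of terms:
- from two vertical steps, b b and b' b', which vanish because of the
  simplicial identities ([pcb_pcb], [pcb'_pcb']);
- from one vertical and one horizontal step, b (1 - tau) - (1 - tau) b' and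
  N b - b' N, which vanish as in the cyclic case ([pcb_sub_tau],
  [pcb'_pcN]);
- from two horizontal steps, N (1 - tau) and (1 - tau) N.  Both telescope to
  1 - tau^(m+1), and tau^(m+1) = T because the sign (-1)^(m(m+1)) is 1
  ([pcN_sub_tau], [sub_tau_pcN]).
Only the last kind differs from the cyclic case, in which T = 1 and the square
is zero; here it gives the square u^-2 (1 - T).

The computations rest on two rules for the signed faces psi_j = (-1)^j d_j on
C_(m+1): tau psi_j = psi_(j+1) tau for j <= m ([tau_sface]) and
psi_0 tau = psi_(m+1) ([sface0_tau]).  Pushing a power of tau across a face
thus raises the index of the face, and each passage of the index through m+1
costs one more tau on the right ([iter_tau_sface_wrap]).  A complete turn
shows that T commutes with the faces, hence with all the operators, and summing
the rule over all powers and all faces gives N b = b' N. *)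

Set Implicit Arguments.
Unset Strict Implicit.
Unset Printing Implicit Defensive.

Import GRing.Theory.
Local Open Scope ring_scope.

(** * Linearity of the operators *)

Section Linearity.
Variables (k : pzRingType) (C : para_precyclic k).

(** Over a noncommutative ring a scalar multiple of a linear map need not be
linear; it is here because signs are central. *)
Lemma linear_signZ (U V : lmodType k) (n : nat) (f : {linear U -> V}) :
  linear (fun x => (-1) ^+ n *: f x).
Proof.
move=> a x y; rewrite linearP scalerDr !scalerA.
by congr (_ *: _ + _); apply: commr_sym; apply: commr_sign.
Qed.

Lemma linear_iter (V : lmodType k) (f : V -> V) n :
  linear f -> linear (iter n f).
Proof. by move=> f_lin; elim: n => [|n IH] a x y //=; rewrite IH f_lin. Qed.

Lemma linear_sum_fun (U V : lmodType k) (I : Type) (r : seq I) (P : pred I)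
    (f : I -> U -> V) :
  (forall i, linear (f i)) -> linear (fun x => \sum_(i <- r | P i) f i x).
Proof.
move=> f_lin a x y; rewrite scaler_sumr -big_split.
by apply: eq_bigr => i _; rewrite f_lin.
Qed.

Lemma pctau_linear m : linear (@pctau k C m).
Proof. exact: linear_signZ. Qed.

HB.instance Definition _ m :=
  GRing.isLinear.Build k (C m) (C m) _ (@pctau k C m) (@pctau_linear m).

Lemma pcT_linear m : linear (@pcT k C m).
Proof. by apply: linear_iter => a x y; rewrite linearP. Qed.

HB.instance Definition _ m :=
  GRing.isLinear.Build k (C m) (C m) _ (@pcT k C m) (@pcT_linear m).

Lemma pcN_linear m : linear (@pcN k C m).
Proof. by apply: linear_sum_fun => i; apply: linear_iter; apply: linearP. Qed.

HB.instance Definition _ m :=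
  GRing.isLinear.Build k (C m) (C m) _ (@pcN k C m) (@pcN_linear m).

Lemma pcb_linear m : linear (@pcb k C m).
Proof. by apply: linear_sum_fun => j; apply: linear_signZ. Qed.

HB.instance Definition _ m :=
  GRing.isLinear.Build k (C m.+1) (C m) _ (@pcb k C m) (@pcb_linear m).

Lemma pcb'_linear m : linear (@pcb' k C m).
Proof. by apply: linear_sum_fun => j; apply: linear_signZ. Qed.

HB.instance Definition _ m :=
  GRing.isLinear.Build k (C m.+1) (C m) _ (@pcb' k C m) (@pcb'_linear m).

(** Absorbing the sign into the face makes it commute with [pctau] without any
sign.  Indexing by [nat] makes [pcb] and [pcb'] sums of the same maps over two
ranges, and avoids casts in index shifts. *)
Definition sface m (j : nat) (x : C m.+1) : C m :=
  (-1) ^+ j *: face C (inord j) x.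

Lemma sface_linear m j : linear (@sface m j).
Proof. exact: linear_signZ. Qed.

HB.instance Definition _ m j :=
  GRing.isLinear.Build k (C m.+1) (C m) _ (@sface m j) (@sface_linear m j).

End Linearity.

(** * Moving the cyclic operator across the faces *)

Section Identities.
Variables (k : pzRingType) (C : para_precyclic k).

Local Notation tau := (@pctau k C _).
Local Notation sf := (@sface k C _).

Lemma pcb_sface m (x : C m.+1) : pcb x = \sum_(0 <= j < m.+2) sf j x.
Proof.
by rewrite big_mkord; apply: eq_bigr => j _; rewrite /sface inord_val.
Qed.

Lemma pcb'_sface m (x : C m.+1) : pcb' x = \sum_(0 <= j < m.+1) sf j x.
Proof.
rewrite big_mkord; apply: eq_bigr => j _; rewrite /sface.
congr (_ *: face C _ x); apply: val_inj.
by rewrite /= inordK // ltnS ltnW.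
Qed.

Lemma tau_sface m j (x : C m.+1) :
  (j <= m)%N -> tau (sf j x) = sf j.+1 (tau x).
Proof.
move=> jm; rewrite /pctau /sface !linearZ_LR /= pct_face // !scalerA -!exprD.
by congr (_ *: _); rewrite addSn addnS !exprS !mulN1r opprK addnC.
Qed.

Lemma sface0_tau m (x : C m.+1) : sf 0 (tau x) = sf m.+1 x.
Proof.
rewrite /pctau /sface linearZ_LR expr0 scale1r; congr (_ *: _).
have -> : inord 0 = ord0 :> 'I_m.+2 by apply: val_inj; rewrite /= inordK.
have -> : inord m.+1 = ord_max :> 'I_m.+2 by apply: val_inj; rewrite /= inordK.
by rewrite face_last.
Qed.

Lemma iter_tau_sum m n (I : Type) (r : seq I) (P : pred I) (F : I -> C m) :
  iter n tau (\sum_(i <- r | P i) F i) = \sum_(i <- r | P i) iter n tau (F i).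
Proof. by elim: n => //= n ->; rewrite linear_sum. Qed.

Lemma iter_tau_sface m i j (x : C m.+1) :
  (i + j <= m.+1)%N -> iter i tau (sf j x) = sf (i + j) (iter i tau x).
Proof.
elim: i => //= i IH ijm; rewrite IH; last exact: ltnW.
by rewrite tau_sface.
Qed.

(** When the face index reaches m+1, tau^i psi_j first becomes
tau^l psi_(m+1) tau^(i-l); then psi_(m+1) = psi_0 tau restarts the index at 0
with an extra tau on the right. *)
Lemma iter_tau_sface_wrap m i j l (x : C m.+1) :
    (i + j = m.+1 + l)%N -> (j <= m.+1)%N -> (l <= m.+1)%N ->
  iter i tau (sf j x) = sf l (iter i.+1 tau x).
Proof.
move=> ijl jm lm; have -> : i = (l + (m.+1 - j))%N.
  by apply/eqP; rewrite -(eqn_add2r j) ijl -addnA subnK // addnC.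
rewrite iterD iter_tau_sface ?subnK // -sface0_tau.
by rewrite iter_tau_sface ?addn0 // -addnS iterD.
Qed.

(** The accumulated sign is (-1)^(m(m+1)) = 1. *)
Lemma pcT_tau m (x : C m) : pcT x = iter m.+1 tau x.
Proof.
have E n : iter n tau x = (-1) ^+ (n * m) *: iter n (pct C m) x.
  elim: n => [|n IH] /=; first by rewrite expr0 scale1r.
  by rewrite IH /pctau linearZ_LR scalerA -exprD mulSn.
by rewrite E -signr_odd oddM /= andNb expr0 scale1r.
Qed.

Lemma pcT_pctau m (x : C m) : tau (pcT x) = pcT (tau x).
Proof. by rewrite !pcT_tau -iterS -iterSr. Qed.

(** This is the case i = m+1, l = j of [iter_tau_sface_wrap]: a complete turn
brings the index of the face back to j. *)
Lemma pcT_sface m j (x : C m.+1) :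
  (j <= m.+1)%N -> sf j (pcT x) = pcT (sf j x).
Proof. by move=> jm; rewrite !pcT_tau (iter_tau_sface_wrap (l := j)). Qed.

Lemma pcT_pcN m (x : C m) : pcN (pcT x) = pcT (pcN x).
Proof.
rewrite /pcN linear_sum; apply: eq_bigr => i _ /=.
by elim: (val i) => //= n ->; rewrite pcT_pctau.
Qed.

Lemma pcT_pcb m (x : C m.+1) : pcb (pcT x) = pcT (pcb x).
Proof.
rewrite !pcb_sface linear_sum; apply: eq_big_nat => j jm.
exact: pcT_sface.
Qed.

Lemma pcT_pcb' m (x : C m.+1) : pcb' (pcT x) = pcT (pcb' x).
Proof.
rewrite !pcb'_sface linear_sum; apply: eq_big_nat => j jm.
by apply: pcT_sface; apply: ltnW.
Qed.

(** * The identities of the cyclic bicomplex *)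

Lemma pcN_sub_tau m (x : C m) : pcN (x - tau x) = x - pcT x.
Proof.
have := telescope_sumr (fun i => iter i tau x) (leq0n m.+1).
rewrite big_mkord sumrB -pcT_tau => /(congr1 -%R); rewrite !opprB => <-.
by rewrite linearB; congr (_ - _); apply: eq_bigr => i _; rewrite -iterSr.
Qed.

Lemma sub_tau_pcN m (x : C m) : pcN x - tau (pcN x) = x - pcT x.
Proof.
rewrite -pcN_sub_tau linearB /=; congr (_ - _).
rewrite /pcN linear_sum; apply: eq_bigr => i _.
by rewrite -iterS -iterSr.
Qed.

(** The sums b and b tau each have one term more than b' and tau b', namely
psi_(m+1) and psi_0 tau, and these two are equal; the other terms agree since
psi_(j+1) tau = tau psi_j. *)
Lemma pcb_sub_tau m (x : C m.+1) :
  pcb (x - tau x) = pcb' x - tau (pcb' x).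
Proof.
rewrite linearB /= !pcb_sface pcb'_sface (linear_sum (@pctau k C m)) /=.
rewrite [\sum_(0 <= j < m.+2) sf j x]big_nat_recr //.
rewrite [\sum_(0 <= j < m.+2) sf j (tau x)]big_nat_recl //=.
rewrite sface0_tau opprD addrA addrK; congr (_ - _).
by apply: eq_big_nat => j jm; rewrite tau_sface.
Qed.

(** Each tau^i psi_j with i <= m and j <= m+1 is one psi_l tau^r with l <= m and
r <= m+1, and conversely: those with i + j <= m give the pairs r <= l, with
r = i, and the others, which wrap around, give the pairs l < r, with
r = i + 1. *)
Lemma pcb'_pcN m (x : C m.+1) : pcb' (pcN x) = pcN (pcb x).
Proof.
pose F i j := sf j (iter i tau x).
have rot i : (i < m.+1)%N -> iter i tau (pcb x) =
    \sum_(i <= j < m.+1) F i j + \sum_(0 <= j < i.+1) F i.+1 j.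
  move=> im; have im' := ltnW im.
  rewrite pcb_sface iter_tau_sum (big_cat_nat (n := m.+1 - i)) //=; last first.
    by rewrite leqW // leq_subr.
  congr (_ + _).
    rewrite -[i in RHS]add0n big_addn; apply: eq_big_nat => j /andP[_ ji].
    by rewrite iter_tau_sface 1?[(j + i)%N]addnC // -leq_subRL // ltnW.
  rewrite -{1}[(m.+1 - i)%N]add0n big_addn subSn ?leq_subr // subKn //.
  apply: eq_big_nat => j ji; rewrite (iter_tau_sface_wrap (l := j)) //.
  - by rewrite addnCA subnKC // addnC.
  - by rewrite -[X in (_ <= X)%N](subnKC im') leq_add2r.
  by apply: leq_trans im'.
(* Both families of sums can be indexed by the same range i < m.+2: the first is
   empty at i = m.+1 and the second, once shifted, is empty at i = 0. *)
rewrite {2}/pcN -(big_mkord xpredT (fun i => iter i tau (pcb x))).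
under eq_big_nat => i im do rewrite rot //.
rewrite big_split /=.
have -> : \sum_(0 <= i < m.+1) \sum_(i <= j < m.+1) F i j =
          \sum_(0 <= i < m.+2) \sum_(i <= j < m.+1) F i j.
  by rewrite [RHS]big_nat_recr //= [X in _ + X]big_geq // addr0.
have -> : \sum_(0 <= i < m.+1) \sum_(0 <= j < i.+1) F i.+1 j =
          \sum_(0 <= i < m.+2) \sum_(0 <= j < i) F i j.
  by rewrite [RHS]big_nat_recl //= [X in X + _]big_geq // add0r.
rewrite -big_split /= pcb'_sface.
have -> : pcN x = \sum_(0 <= i < m.+2) iter i tau x by rewrite big_mkord.
under [LHS]eq_bigr do rewrite linear_sum.
rewrite exchange_big_nat /=; apply: eq_big_nat => i im.
by rewrite addrC -big_cat_nat.
Qed.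

(** The cancellation behind both b b = 0 and b' b' = 0: the pairs i < j cancel
against the pairs j <= i.  In the induction on n, the new column j = n + 1
cancels against the new row i = n. *)
Lemma simplicial_sum0 (V : zmodType) n (f : nat -> nat -> V) :
    (forall i j, (i < j <= n)%N -> f i j = - f j.-1 i) ->
  \sum_(0 <= i < n) \sum_(0 <= j < n.+1) f i j = 0.
Proof.
elim: n => [|n IH] f_anti; first by rewrite big_geq.
under eq_bigr do rewrite big_nat_recr //=.
rewrite big_split /= big_nat_recr //= IH ?add0r; last first.
  by move=> i j /andP[ij jn]; rewrite f_anti // ij leqW.
rewrite -big_split /= big_nat big1 // => i /andP[_ im].
by rewrite (f_anti i n.+1) ?im //= subrr.
Qed.

Lemma sface_sface m i j (x : C m.+2) :
  (i < j <= m.+2)%N -> sf i (sf j x) = - sf j.-1 (sf i x).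
Proof.
move=> ij; rewrite /sface -scaleNr !linearZ_LR /= face_face // !scalerA.
rewrite mulNr -!exprD; congr (_ *: _).
case: j ij => // j _ /=; rewrite addnS exprS mulN1r; congr (- _).
by rewrite addnC.
Qed.

Lemma pcb_pcb m (x : C m.+2) : pcb (pcb x) = 0.
Proof.
rewrite !pcb_sface; under eq_bigr do rewrite linear_sum.
by apply: (@simplicial_sum0 _ m.+2 (fun i j => sf i (sf j x))) => i j;
  apply: sface_sface.
Qed.

Lemma pcb'_pcb' m (x : C m.+2) : pcb' (pcb' x) = 0.
Proof.
rewrite !pcb'_sface; under eq_bigr do rewrite linear_sum.
apply: (@simplicial_sum0 _ m.+1 (fun i j => sf i (sf j x))) => i j.
by move=> /andP[ij jm]; apply: sface_sface; rewrite ij leqW.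
Qed.

(** * The total complex *)

Lemma pcT_bij m : bijective (@pcT k C m).
Proof.
rewrite /pcT; elim: m.+1 => [|n IH]; first by exists id.
exact: bij_comp (pct_bij C m) IH.
Qed.

Lemma natnat_T_bij m : bijective (@natnat_T k C m).
Proof.
have [g gP] : exists g : forall q : 'I_m.+1, C q -> C q,
    forall q : 'I_m.+1,
      cancel (@pcT k C q) (g q) /\ cancel (g q) (@pcT k C q).
  (* The inverses of [pcT] are known only to exist; a finite choice over q
     gathers them. *)
  apply: (fin_all_exists (U := fun q : 'I_m.+1 => C q -> C q)
    (P := fun q g => cancel (@pcT k C q) g /\ cancel g (@pcT k C q))) => q.
  by have [g gK Kg] := pcT_bij q; exists g.
exists (fun y : natnat C m => [ffun q : 'I_m.+1 => (g q (y q) : C q)]).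
- by move=> x; apply/ffunP => q; rewrite !ffunE (gP q).1.
- by move=> x; apply/ffunP => q; rewrite !ffunE (gP q).2.
Qed.

Lemma natnat_linE m (a : k) (x y : natnat C m) (q : 'I_m.+1) :
  (a *: x + y) q = a *: (x q : C q) + (y q : C q).
Proof. by rewrite !ffunE. Qed.

Lemma natnat_TE m (x : natnat C m) (q : 'I_m.+1) :
  natnat_T x q = pcT (x q : C q).
Proof. by rewrite ffunE. Qed.

(** The type of a coefficient depends on the value of its index, so two indices
with the same value cannot be rewritten into each other inside an operator;
the equality of the coefficients can. *)
Lemma natnat_coef_irr m (x : natnat C m) q (h h' : (q < m.+1)%N) :
  x (Ordinal h) = x (Ordinal h') :> C q.
Proof. by rewrite (bool_irrelevance h h'). Qed.

(** The coefficients at q and q.+1 are taken with arbitrary bound proofs, so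
that the formula can be iterated without any comparison of ordinals. *)
Lemma natnat_dE m (x : natnat C m.+1) q (h : (q < m.+1)%N) (h1 : (q < m.+2)%N)
    (h2 : (q.+1 < m.+2)%N) (y := x (Ordinal h1)) (z := x (Ordinal h2)) :
  natnat_d x (Ordinal h) =
    (if odd (m - q) then pcN (y : C q) else y - tau (y : C q)) +
    (if odd (m - q) then - pcb' (z : C q.+1) else pcb (z : C q.+1)).
Proof.
rewrite /natnat_d !ffunE /= subSn //= if_neg.
have -> : x (widen_ord (leqnSn m.+1) (Ordinal h)) = y :> C q.
  exact: natnat_coef_irr.
by have -> : x (lift ord0 (Ordinal h)) = z :> C q.+1 by exact: natnat_coef_irr.
Qed.

Lemma uinv2E m (x : natnat C m.+2) q (h : (q < m.+1)%N) (h' : (q < m.+3)%N) :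
  uinv2 x (Ordinal h) = x (Ordinal h').
Proof.
by rewrite /uinv2 !ffunE; apply: natnat_coef_irr.
Qed.

Lemma natnat_d_linear m : linear (@natnat_d k C m).
Proof.
move=> a x y; apply/ffunP => -[q h].
have h1 : (q < m.+2)%N by apply: ltnW.
have h2 : (q.+1 < m.+2)%N by [].
rewrite natnat_linE !(natnat_dE _ h h1 h2) !natnat_linE.
case: ifP => _; rewrite !linearP /=.
  by rewrite addrACA -scalerDr.
by rewrite [X in X + _]addrACA -scalerDr addrACA -scalerDr.
Qed.

Lemma natnat_dd m (x : natnat C m.+2) :
  natnat_d (natnat_d x) = uinv2 (x - natnat_T x).
Proof.
apply/ffunP => -[q h].
have h1 : (q < m.+2)%N by apply: ltnW.
have h2 : (q.+1 < m.+2)%N by [].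
have g1 : (q < m.+3)%N by apply: ltnW.
have g2 : (q.+1 < m.+3)%N by [].
have g3 : (q.+2 < m.+3)%N by [].
rewrite (natnat_dE _ h h1 h2) (natnat_dE _ h1 g1 g2) (natnat_dE _ h2 g2 g3).
rewrite (uinv2E _ h g1) !ffunE.
set y := x (Ordinal g1); set z := x (Ordinal g2); set w := x (Ordinal g3).
(* Now y, z and w are the coefficients at u^(n+2), u^(n+1) and u^n, where
   n = m - q is odd in the first case and even in the second; in both, the two
   mixed terms in z cancel. *)
rewrite subSS subSn //=; case: (odd _) => /=.
  rewrite (linearD (@pcN k C q)) (linearB (@pcb' k C q)) /=.
  by rewrite pcN_sub_tau pcb'_pcb' pcb'_pcN subr0 addrK.
rewrite (linearB (@pctau k C q)) (linearD (@pcb k C q)) /=.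
rewrite pcb_pcb addr0 pcb_sub_tau.
by rewrite opprD [X in X + _]addrACA sub_tau_pcN -opprD subrK.
Qed.

Lemma natnat_d_uinv2 m (x : natnat C m.+3) :
  natnat_d (uinv2 x) = uinv2 (natnat_d x).
Proof.
apply/ffunP => -[q h].
have h1 : (q < m.+2)%N by apply: ltnW.
have h2 : (q.+1 < m.+2)%N by [].
have g : (q < m.+3)%N by apply: ltnW.
have g1 : (q < m.+4)%N by apply: ltnW.
have g2 : (q.+1 < m.+4)%N by [].
rewrite (natnat_dE _ h h1 h2) (uinv2E _ h g) (natnat_dE _ g g1 g2).
by rewrite (uinv2E _ h1 g1) (uinv2E _ h2 g2) (@subSn q m.+1) //
  (@subSn q m) //= negbK.
Qed.

Lemma natnat_d_T m (x : natnat C m.+1) :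
  natnat_d (natnat_T x) = natnat_T (natnat_d x).
Proof.
apply/ffunP => -[q h].
have h1 : (q < m.+2)%N by apply: ltnW.
have h2 : (q.+1 < m.+2)%N by [].
rewrite natnat_TE !(natnat_dE _ h h1 h2) !natnat_TE linearD.
by case: ifP => _ /=; rewrite ?(linearN, linearB) /= ?pcT_pcN ?pcT_pcb'
  ?pcT_pctau ?pcT_pcb.
Qed.

End Identities.

Theorem proposition6p2 (k : pzRingType) (C : para_precyclic k) :
  is_para_S_module (C := fun m => natnat C m : lmodType k)
    (@natnat_d k C) (@uinv2 k C) (@natnat_T k C).
Proof.
split=> m.
- exact: natnat_d_linear.
- by move=> a x y; apply/ffunP => q; rewrite !ffunE.
- by move=> a x y; apply/ffunP => q; rewrite !ffunE linearP.
- exact: natnat_T_bij.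
- exact: natnat_dd.
- exact: natnat_d_uinv2.
- exact: natnat_d_T.
- by move=> x; apply/ffunP => q; rewrite !ffunE.
Qed.
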